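(* For each even integer $k\ge 2$ there exists a finite solvable group $G$ such that the prime graph $\Delta(G)$ is $k$-regular and $|\rho(G)|=k+2$.
   Context: For a finite group $G$, $\mathrm{Irr}(G)$ is the set of irreducible complex characters of $G$, $\mathrm{cd}(G)=\{\chi(1) : \chi\in\mathrm{Irr}(G)\}$ is the set of character degrees, and $\rho(G)$ is the set of primes dividing some element of $\mathrm{cd}(G)$. The prime graph $\Delta(G)$ is the simple undirected graph with vertex set $\rho(G)$ in which two distinct primes $p,q\in\rho(G)$ are adjacent if and only if $pq$ divides some $a\in\mathrm{cd}(G)$. A graph is $k$-regular if every vertex has degree $k$. *)

(* Defs.v *)
From HB Require Import structures.
From mathcomp Require Import all_boot all_order all_fingroup all_algebra.
From mathcomp Require Import all_solvable all_field all_character.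
Set Implicit Arguments.
Unset Strict Implicit.
Unset Printing Implicit Defensive.
Import GRing.Theory Num.Theory.

Section PrimeGraph.
Variables (gT : finGroupType) (G : {group gT}).

(* The degree 'chi_i 1 is a natural number embedded in algC; Num.truncn reads
   it back in nat (see mem_cd). *)
Definition cd : seq nat :=
  undup [seq Num.truncn ('chi[G]_i 1%g) | i : Iirr G].

Definition rho : seq nat := undup (flatten [seq primes a | a <- cd]).

Definition prime_graph : rel (seq_sub rho) :=
  fun p q => (val p != val q) && has (fun a => val p * val q %| a) cd.

Lemma mem_cd a :
  reflect (exists i : Iirr G, ('chi_i 1%g = a%:R)%R) (a \in cd).
Proof.
rewrite mem_undup; apply: (iffP mapP) => [[i _ ->] | [i chi1]]; exists i.
- by rewrite Num.Theory.truncnK ?Cnat_irr1.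
- by rewrite mem_enum.
- by rewrite chi1 natrK.
Qed.

Lemma mem_rho p :
  reflect (exists2 a, a \in cd & prime p && (p %| a)) (p \in rho).
Proof.
rewrite mem_undup; apply: (iffP flatten_mapP) => -[a cd_a] pa; exists a => //.
  by move: pa; rewrite mem_primes => /and3P[-> _ ->].
case/andP: pa => pr_p p_a; rewrite mem_primes pr_p p_a andbT /=.
have /mem_cd[i chi1] := cd_a.
by have := irr1_gt0 i; rewrite chi1 ltr0n.
Qed.

Lemma rho_uniq : uniq rho. Proof. exact: undup_uniq. Qed.

Lemma prime_graph_sym : symmetric prime_graph.
Proof.
move=> p q; rewrite /prime_graph eq_sym; congr (_ && _).
by apply: eq_has => a; rewrite mulnC.
Qed.

Lemma prime_graph_irrefl : irreflexive prime_graph.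
Proof. by move=> p; rewrite /prime_graph eqxx. Qed.

End PrimeGraph.

Definition regular_graph (V : finType) (k : nat) (e : rel V) : Prop :=
  forall v : V, #|[set w | e v w]| = k.

(* Main.v *)
Require Import Defs.
From HB Require Import structures.
From mathcomp Require Import all_boot all_order all_fingroup all_algebra.
From mathcomp Require Import all_solvable all_field all_character.
From mathcomp Require Import zify ring.

(* The graph is the complement of a perfect matching. If q is prime and p = 1
   mod q is prime, let a cyclic group U of order q of units of F_p act on the
   Heisenberg group P over F_p by (x, y, z) |-> (a x, a^-1 y, z). In the
   resulting G the degree d of a character divides |G : Z| = p^2 q and satisfies
   d^2 <= p^2 q, so pq does not divide d; p occurs because P is nonabelian, and q
   because G has a nonabelian quotient of order pq. The degrees of a direct
   product are the products of the degrees of its factors, so direct products of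
   such groups, for disjoint pairs {p, q}, join the corresponding graphs. *)

Set Implicit Arguments.
Unset Strict Implicit.
Unset Printing Implicit Defensive.
Import Order.TTheory GRing.Theory Num.Theory.

Local Open Scope ring_scope.
Local Open Scope group_scope.
Local Open Scope nat_scope.

(** * Character degrees: divisibility, size bounds, subgroups and quotients *)

Section Degrees.
Variables (gT : finGroupType) (G : {group gT}).

Lemma cd_1 : 1 \in cd G.
Proof. by apply/mem_cd; exists 0%R; rewrite irr0 cfun11. Qed.

Lemma cd_dvd_order a : a \in cd G -> a %| #|G|.
Proof. by case/mem_cd=> i Di; rewrite -dvdC_nat -[d in (d %| _)%C]Di dvd_irr1_cardG. Qed.

(** The center of a group is the intersection of the centers of its irreducible characters; bounds
    by the index of ['Z('chi_i)] thus pass to the index of ['Z(G)]. *)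
Lemma sub_center_cfcenter i : 'Z(G) \subset 'Z('chi[G]_i)%CF.
Proof. by rewrite -cap_cfcenter_irr (bigcap_inf i). Qed.

Lemma cd_dvd_index_center a : a \in cd G -> a %| #|G : 'Z(G)|.
Proof.
case/mem_cd=> i Di; apply: (@dvdn_trans #|G : 'Z('chi_i)%CF|).
  by rewrite -dvdC_nat -[d in (d %| _)%C]Di dvd_irr1_index_center.
exact: indexgS (sub_center_cfcenter i).
Qed.

Lemma cd_sqr_le_index_center a : a \in cd G -> a ^ 2 <= #|G : 'Z(G)|.
Proof.
case/mem_cd=> i Di; apply: (@leq_trans #|G : 'Z('chi_i)%CF|).
  by rewrite -leC_nat natrX -Di; apply: (irr1_bound i).1.
by rewrite dvdn_leq // indexgS ?sub_center_cfcenter.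
Qed.

Lemma cd_sqr_le_order a : a \in cd G -> a ^ 2 <= #|G|.
Proof.
move/cd_sqr_le_index_center/leq_trans; apply.
by rewrite dvdn_leq ?cardG_gt0 ?dvdn_indexg.
Qed.

Lemma cd_nonabelian : ~~ abelian G -> exists2 a, a \in cd G & 1 < a.
Proof.
move=> nabG; have [/hasP // | noA] := boolP (has (ltn 1) (cd G)).
case/char_abelianP: nabG => i; rewrite qualifE /= irr_char /=.
have [a Da] : exists a, ('chi_i 1%g = a%:R)%R.
  by exists (Num.truncn ('chi_i 1%g)); rewrite truncnK ?Cnat_irr1.
have cda: a \in cd G by apply/mem_cd; exists i.
have := hasPn noA a cda; rewrite -leqNgt.
have := irr1_gt0 i; rewrite Da ltr0n => a0 a1.
by rewrite (_ : a = 1%N) //; apply/eqP; rewrite eqn_leq a1.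
Qed.

(** Take a constituent of the character induced from N. By Frobenius reciprocity the given character
    occurs in its restriction, and by Clifford its degree is then a multiple of b. *)
Lemma cd_normal (N : {group gT}) b :
  N <| G -> b \in cd N -> exists2 a, a \in cd G & b %| a.
Proof.
move=> nsNG /mem_cd[j Dj]; have [i chiGi] := constt_cfInd_irr j (normal_sub nsNG).
have := chiGi; rewrite constt_Ind_Res => /(dvdn_constt_Res1_irr1 nsNG)[n].
rewrite Dj -natrM => Di; exists (n * b)%N; last exact: dvdn_mull.
by apply/mem_cd; exists i.
Qed.

Lemma cd_quotient (N : {group gT}) b : N <| G -> b \in cd (G / N) -> b \in cd G.
Proof.
move=> nsNG /mem_cd[i Di]; apply/mem_cd; exists (mod_Iirr i).
by rewrite mod_IirrE // cfModE // morph1.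
Qed.

End Degrees.

(** * Degrees under isomorphism and direct products *)

Lemma cd_isog (aT rT : finGroupType) (G : {group aT}) (H : {group rT}) :
  G \isog H -> {subset cd G <= cd H}.
Proof.
case/isogP=> f injf imf a /mem_cd[i Di].
have isoGH : isom G H f by apply/isomP.
by apply/mem_cd; exists (isom_Iirr isoGH i); rewrite isom_IirrE cfIsom1.
Qed.

Lemma cd_dprod (gT : finGroupType) (G K H : {group gT}) a :
  K \x H = G ->
  reflect (exists b c, [/\ b \in cd K, c \in cd H & a = b * c]%N) (a \in cd G).
Proof.
move=> KxH; apply: (iffP (mem_cd _ _)) => [[i Di] | [b [c [cdb cdc ->]]]].
  have [[j k] Dj] := codomP (dprod_Iirr_onto KxH i).
  pose d (gT1 : finGroupType) (L : {group gT1}) (l : Iirr L) := Num.truncn ('chi_l 1%g).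
  have dE gT1 (L : {group gT1}) (l : Iirr L) : ('chi_l 1%g = (d _ _ l)%:R)%R.
    by rewrite truncnK ?Cnat_irr1.
  exists (d _ _ j), (d _ _ k); split; try by apply/mem_cd; eexists; apply: dE.
  (* Writing 1 as 1 * 1 exposes the value of a product character as a product of two values. *)
  apply/eqP; rewrite -eqC_nat -Di Dj dprod_IirrE -{1}(mulg1 1%g) cfDprodE //.
  by rewrite !dE natrM.
have [[j Dj] [k Dk]] := (mem_cd _ _ cdb, mem_cd _ _ cdc).
exists (dprod_Iirr KxH (j, k)); rewrite dprod_IirrE -{1}(mulg1 1%g) cfDprodE //.
by rewrite Dj Dk natrM.
Qed.

Lemma cd_setX (gT1 gT2 : finGroupType) (G : {group gT1}) (H : {group gT2}) a :
  reflect (exists b c, [/\ b \in cd G, c \in cd H & a = b * c]%N)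
          (a \in cd (setX_group G H)).
Proof.
have isoG := isog_setX1 gT2 G; have isoH := isog_set1X gT1 H.
have isoG' := isog_symr isoG; have isoH' := isog_symr isoH.
apply: (iffP (cd_dprod a (setX_dprod G H))) => -[b [c [cdb cdc ->]]]; exists b, c.
  by rewrite (cd_isog isoG') ?(cd_isog isoH').
by split=> //; [apply: (cd_isog isoG) | apply: (cd_isog isoH)].
Qed.

(** * The prime graph of a direct product *)

Definition adj (gT : finGroupType) (G : {group gT}) : rel nat :=
  fun p q => (p != q) && has (fun a => p * q %| a) (cd G).

(* The prime graph is a cocktail party graph on 2m vertices; the count is 2
   because p is not adjacent to itself. *)
Definition cocktail (gT : finGroupType) (G : {group gT}) (m : nat) :=
  size (rho G) = m.*2 /\ {in rho G, forall p, count (predC (adj G p)) (rho G) = 2}.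

Lemma cocktail_regular (gT : finGroupType) (G : {group gT}) m :
  cocktail G m.+1 -> regular_graph m.*2 (prime_graph (G := G)).
Proof.
case=> szG cG v; have := cG (val v) (valP v).
have -> : #|[set w | prime_graph v w]| = count (adj G (val v)) (rho G).
  transitivity (count (adj G (val v)) [seq val w | w <- seq_sub_enum (rho G)]).
    by rewrite cardsE cardE size_filter count_map unlock.
  by rewrite val_seq_sub_enum ?rho_uniq.
by have := count_predC (adj G (val v)) (rho G); rewrite szG; lia.
Qed.

Lemma mem_rho_setX (gT1 gT2 : finGroupType) (G : {group gT1}) (H : {group gT2}) p :
  (p \in rho (setX_group G H)) = (p \in rho G) || (p \in rho H).
Proof.
apply/mem_rho/orP => [[a /cd_setX[b [c [cdb cdc ->]]] /andP[pr_p]] | ].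
  by rewrite Euclid_dvdM // => /orP[] pd; [left | right]; apply/mem_rho;
     [exists b | exists c]; rewrite ?pr_p.
case=> /mem_rho[a cda pa]; exists a => //; apply/cd_setX.
  by exists a, 1; rewrite muln1 cd_1.
by exists 1, a; rewrite mul1n cd_1.
Qed.

(** A degree of the product is b * c, and c is coprime to p and q because neither divides a degree
    of H; hence pq divides b * c only if it divides b. *)
Lemma adj_setXl (gT1 gT2 : finGroupType) (G : {group gT1}) (H : {group gT2}) p q :
    prime p -> prime q -> p \notin rho H -> q \notin rho H ->
  adj (setX_group G H) p q = adj G p q.
Proof.
move=> pr_p pr_q pH qH; congr (_ && _).
have coH r c : prime r -> r \notin rho H -> c \in cd H -> coprime r c.
  move=> pr_r rH cdc; rewrite prime_coprime //; apply: contra rH => rc.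
  by apply/mem_rho; exists c; rewrite ?pr_r.
apply/hasP/hasP => -[a].
  case/cd_setX=> b [c [cdb cdc ->]]; rewrite Gauss_dvdl; first by exists b.
  by rewrite coprimeMl !coH.
move=> cda pqa; exists a => //; apply/cd_setX; exists a, 1;
  by rewrite muln1 cd_1.
Qed.

Lemma adj_setXr (gT1 gT2 : finGroupType) (G : {group gT1}) (H : {group gT2}) p q :
    prime p -> prime q -> p \notin rho G -> q \notin rho G ->
  adj (setX_group G H) p q = adj H p q.
Proof.
move=> pr_p pr_q pG qG; congr (_ && _).
have coG r b : prime r -> r \notin rho G -> b \in cd G -> coprime r b.
  move=> pr_r rG cdb; rewrite prime_coprime //; apply: contra rG => rb.
  by apply/mem_rho; exists b; rewrite ?pr_r.
apply/hasP/hasP => -[a].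
  case/cd_setX=> b [c [cdb cdc ->]]; rewrite Gauss_dvdr; first by exists c.
  by rewrite coprimeMl !coG.
move=> cda pqa; exists a => //; apply/cd_setX; exists 1, a;
  by rewrite mul1n cd_1.
Qed.

Lemma adj_setX_cross (gT1 gT2 : finGroupType) (G : {group gT1}) (H : {group gT2}) p q :
    p \in rho G -> q \in rho H -> p != q -> adj (setX_group G H) p q.
Proof.
case/mem_rho=> b cdb /andP[_ pb] /mem_rho[c cdc /andP[_ qc]] npq.
rewrite /adj npq; apply/hasP; exists (b * c); last exact: dvdn_mul.
by apply/cd_setX; exists b, c.
Qed.

Lemma adj_sym (gT : finGroupType) (G : {group gT}) p q : adj G p q = adj G q p.
Proof. by rewrite /adj eq_sym; congr andb; apply: eq_has => a; rewrite mulnC. Qed.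

Lemma rho_prime (gT : finGroupType) (G : {group gT}) p : p \in rho G -> prime p.
Proof. by case/mem_rho=> a _ /andP[]. Qed.

(** The graph of the product is the join of two graphs on disjoint vertex sets, so the
    non-neighbours of a vertex all lie in its own factor, where there are two of them. *)
Lemma cocktail_setX (gT1 gT2 : finGroupType) (G : {group gT1}) (H : {group gT2}) m n :
    ~~ has (mem (rho G)) (rho H) -> cocktail G m -> cocktail H n ->
  cocktail (setX_group G H) (m + n).
Proof.
move=> disj [szG cG] [szH cH].
have rhoE : perm_eq (rho (setX_group G H)) (rho G ++ rho H).
  apply: uniq_perm; rewrite ?rho_uniq ?cat_uniq ?disj ?rho_uniq //.
  by move=> p; rewrite mem_rho_setX mem_cat.
have dGH p q : p \in rho G -> q \in rho H -> p != q.
  by move=> pG qH; apply: contraNneq disj => pq; apply/hasP; exists q; rewrite //= -pq.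
have notH p : p \in rho G -> p \notin rho H.
  by move=> pG; apply/negP => pH; move: (dGH p p pG pH); rewrite eqxx.
have notG p : p \in rho H -> p \notin rho G.
  by move=> pH; apply/negP => pG; move: (dGH p p pG pH); rewrite eqxx.
split; first by rewrite (perm_size rhoE) size_cat szG szH doubleD.
move=> p; rewrite (perm_mem rhoE) mem_cat (seq.permP rhoE) count_cat => /orP[pG | pH].
  rewrite -[RHS]addn0 -(cG p pG); congr (_ + _).
    apply: eq_in_count => q qG /=.
    by rewrite adj_setXl ?notH ?(rho_prime pG) ?(rho_prime qG).
  apply/eqP; rewrite -leqn0 leqNgt -has_count -all_predC; apply/allP => q qH /=.
  by rewrite negbK adj_setX_cross ?dGH.
rewrite -[RHS]add0n -(cH p pH); congr (_ + _).
  apply/eqP; rewrite -leqn0 leqNgt -has_count -all_predC; apply/allP => q qG /=.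
  by rewrite negbK adj_sym adj_setX_cross ?dGH.
by apply: eq_in_count => q qH /=; rewrite adj_setXr ?notG ?(rho_prime pH) ?(rho_prime qH).
Qed.

(** * Groups of order p^3 q whose prime graph is two isolated vertices *)

Section TwoDegrees.
Variables (gT : finGroupType) (G P A Z : {group gT}) (p q : nat).
Hypotheses (pr_p : prime p) (pr_q : prime q) (q_lt_p : q < p).
Hypotheses (oG : #|G| = p ^ 3 * q) (oP : #|P| = p ^ 3) (oA : #|A| = p ^ 2).
Hypotheses (oZ : #|Z| = p) (sZZ : Z \subset 'Z(G)).
Hypotheses (nsPG : P <| G) (nsAG : A <| G).
Hypotheses (nabP : ~~ abelian P) (nabGA : ~~ abelian (G / A)).

Lemma cd_bounds a : a \in cd G -> a %| p ^ 2 * q /\ a ^ 2 <= p ^ 2 * q.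
Proof.
have iZ : #|G : Z| = p ^ 2 * q.
  have sZG : Z \subset G := subset_trans sZZ (center_sub G).
  by rewrite -divgS // oG oZ expnS -mulnA mulKn ?prime_gt0.
move=> cda; rewrite -iZ; split.
  by apply: dvdn_trans (cd_dvd_index_center cda) _; apply: indexgS.
apply: leq_trans (cd_sqr_le_index_center cda) _.
by rewrite dvdn_leq // indexgS.
Qed.

Lemma not_mulpq_dvd_cd a : a \in cd G -> ~~ (p * q %| a).
Proof.
move=> cda; have [da a2] := cd_bounds cda; have p0 := prime_gt0 pr_p.
have q1 := prime_gt1 pr_q.
have a0 : 0 < a by apply: dvdn_gt0 da; rewrite muln_gt0 expn_gt0 p0 prime_gt0.
apply/negP => /(dvdn_leq a0) pqa; move: a2; rewrite leqNgt => /negP; apply.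
apply: leq_trans (_ : (p * q) ^ 2 <= _); last by rewrite leq_exp2r.
by rewrite expnMn ltn_pmul2l ?expn_gt0 ?p0 // -[X in X < _]expn1 ltn_exp2l.
Qed.

Lemma rho_two_degrees : rho G =i [:: p; q].
Proof.
have p_in : p \in rho G.
  have [b cdb b1] := cd_nonabelian nabP.
  have [a cda dba] := cd_normal nsPG cdb.
  apply/mem_rho; exists a; rewrite // pr_p; apply: dvdn_trans dba.
  (* A nonlinear degree of the p-group P is a positive power of p. *)
  have := cd_dvd_order cdb; rewrite oP => /(dvdn_pfactor _ _ pr_p)[[|e] _ Db].
    by rewrite Db in b1.
  by rewrite Db expnS dvdn_mulr.
have q_in : q \in rho G.
  have [b cdb b1] := cd_nonabelian nabGA.
  apply/mem_rho; exists b; first exact: cd_quotient cdb.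
  have oGA : #|G / A| = p * q.
    rewrite card_quotient ?normal_norm // -divgS ?normal_sub // oG oA expnS.
    by rewrite mulnAC mulnK // expn_gt0 prime_gt0.
  have b2 := cd_sqr_le_order cdb; have bpq := cd_dvd_order cdb.
  rewrite oGA in b2 bpq; rewrite pr_q.
  (* If p divided b, then p^2 <= b^2 <= pq < p^2. So b, a divisor of pq greater than 1, must be
     q. *)
  have nb : coprime b p.
    rewrite coprime_sym prime_coprime //; apply/negP => /(dvdn_leq (ltnW b1)) pb.
    move: b2; rewrite leqNgt => /negP; apply.
    apply: leq_trans (_ : p ^ 2 <= _); last by rewrite leq_exp2r.
    by rewrite -mulnn ltn_pmul2l ?prime_gt0.
  rewrite Gauss_dvdr // in bpq.
  have [_ /(_ b bpq)/orP[]/eqP Db] := primeP pr_q; first by rewrite Db in b1.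
  by rewrite Db dvdnn.
move=> r; rewrite !inE; apply/idP/orP => [|[]/eqP-> //].
case/mem_rho=> a cda /andP[pr_r ra]; have [da _] := cd_bounds cda.
have := dvdn_trans ra da; rewrite Euclid_dvdM // Euclid_dvdX // andbT.
by rewrite !dvdn_prime2 // => /orP.
Qed.

Lemma cocktail_two_degrees : cocktail G 1.
Proof.
have npq : p != q by rewrite gtn_eqF.
have rhoE : perm_eq (rho G) [:: p; q].
  by apply: uniq_perm rho_two_degrees; rewrite ?rho_uniq //= inE npq.
have nadj : has (fun a => p * q %| a) (cd G) = false.
  by apply/hasPn => a; apply: not_mulpq_dvd_cd.
split=> [|r]; first by rewrite (perm_size rhoE).
rewrite (seq.permP rhoE) rho_two_degrees !inE => /orP[]/eqP-> /=.
  by rewrite /adj eqxx nadj andbF.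
rewrite (adj_sym G q p) /adj eqxx nadj andbF //.
Qed.

End TwoDegrees.

(** * The Heisenberg group extended by a group of units *)

Section TwistedHeisenberg.
Variable F : finFieldType.

(* (a, x, y, z) encodes the matrix [[1, x, z], [0, a, y], [0, 0, 1]]. *)
Definition theis : Type := ({unit F} * F * F * F)%type.
HB.instance Definition _ := Finite.on theis.

Local Open Scope ring_scope.

(** The matrix product. Conjugation by (a, 0, 0, 0) sends (1, x, y, z) to (1, a x, a^-1 y, z), which
    is the intended action. *)
Definition theis_mul (u v : theis) : theis :=
  let: (a, x, y, z) := u in let: (b, x', y', z') := v in
  ((a * b)%g, x' + x * val b, val a * y' + y, z' + x * y' + z).
Definition theis_one : theis := (1%g, 0, 0, 0).
Definition theis_inv (u : theis) : theis :=
  let: (a, x, y, z) := u in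
  (a^-1%g, - (x / val a), - (y / val a), x * y / val a - z).

Lemma theis_mulA : associative theis_mul.
Proof.
move=> [[[a x] y] z] [[[b x'] y'] z'] [[[c x''] y''] z''] /=.
by rewrite mulgA; congr (_, _, _, _) => /=; ring.
Qed.

Lemma theis_mul1 : left_id theis_one theis_mul.
Proof.
move=> [[[a x] y] z] /=.
by rewrite mul1g; congr (_, _, _, _) => /=; ring.
Qed.

Lemma theis_mulV : left_inverse theis_one theis_inv theis_mul.
Proof.
move=> [[[a x] y] z] /=; have a0 : val a != 0 by rewrite -unitfE (valP a).
by rewrite mulVg; congr (_, _, _, _) => /=; field.
Qed.

HB.instance Definition _ :=
  Finite_isGroup.Build theis theis_mulA theis_mul1 theis_mulV.

(** The subgroups used below all constrain a, x and y independently and leave z free, so one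
    construction gives their group laws and orders. *)
Definition theis_set (U : {set {unit F}}) (B C : {set F}) : {set theis} :=
  setX (setX (setX U B) C) [set: F].

Lemma in_theis_set U B C a x y z :
  (((a, x, y, z) : theis) \in theis_set U B C) = [&& a \in U, x \in B & y \in C].
Proof. by rewrite !inE /= andbT -andbA. Qed.

Lemma card_theis_set U B C : #|theis_set U B C| = (#|U| * #|B| * #|C| * #|F|)%N.
Proof. by rewrite !cardsX cardsT. Qed.

(** The ideals of F, in the form that matches the x and y coordinates of a product: x' + x b and a
    y' + y. *)
Definition ideal_set (B : {set F}) :=
  0 \in B /\ {in B &, forall x y c, x + c * y \in B}.

Lemma ideal_setT : ideal_set [set: F].
Proof. by split=> [|x y *]; rewrite !inE. Qed.

Lemma ideal_set0 : ideal_set [set 0].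
Proof.
split=> [|x y]; rewrite !inE // => /eqP-> /eqP-> c.
by rewrite mulr0 addr0.
Qed.

Lemma theis_group_set (U : {group {unit F}}) B C :
  ideal_set B -> ideal_set C -> group_set (theis_set U B C).
Proof.
move=> [B0 idB] [C0 idC]; apply/group_setP; split.
  by rewrite in_theis_set group1 B0 C0.
move=> [[[a x] y] z] [[[b x'] y'] z']; rewrite !in_theis_set.
case/and3P=> Ua Bx Cy /and3P[Ub Bx' Cy']; rewrite groupM //=.
by rewrite mulrC idB //= addrC idC.
Qed.

Variable U : {group {unit F}}.

Definition theis_grp : {group theis} :=
  Group (theis_group_set U ideal_setT ideal_setT).
Definition heis_grp : {group theis} :=
  Group (theis_group_set 1 ideal_setT ideal_setT).
Definition yz_grp : {group theis} :=
  Group (theis_group_set 1 ideal_set0 ideal_setT).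
Definition z_grp : {group theis} :=
  Group (theis_group_set 1 ideal_set0 ideal_set0).

Lemma mem_theis_grp a x y z : (((a, x, y, z) : theis) \in theis_grp) = (a \in U).
Proof. by rewrite in_theis_set !inE !andbT. Qed.

Lemma mem_heis_grp a x y z : (((a, x, y, z) : theis) \in heis_grp) = (a == 1%g).
Proof. by rewrite in_theis_set !inE !andbT. Qed.

Lemma mem_yz_grp a x y z :
  (((a, x, y, z) : theis) \in yz_grp) = (a == 1%g) && (x == 0).
Proof. by rewrite in_theis_set !inE andbT. Qed.

Lemma mem_z_grp a x y z :
  (((a, x, y, z) : theis) \in z_grp) = [&& a == 1%g, x == 0 & y == 0].
Proof. by rewrite in_theis_set !inE. Qed.

Lemma mul_theisE a x y z b x' y' z' :
  (((a, x, y, z) : theis) * ((b, x', y', z') : theis))%g =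
    ((a * b)%g, x' + x * val b, val a * y' + y, z' + x * y' + z) :> theis.
Proof. by []. Qed.

Lemma inv_theisE a x y z :
  ((a, x, y, z) : theis)^-1%g =
    (a^-1%g, - (x / val a), - (y / val a), x * y / val a - z) :> theis.
Proof. by []. Qed.

Lemma sub_z_grp_center : z_grp \subset 'Z(theis_grp).
Proof.
apply/subsetP=> -[[[a x] y] z]; rewrite mem_z_grp => /and3P[/eqP-> /eqP-> /eqP->].
apply/centerP; split; first by rewrite mem_theis_grp group1.
move=> [[[b x'] y'] z'] _; rewrite /commute !mul_theisE mulg1 mul1g.
by congr (_, _, _, _); rewrite /=; ring.
Qed.

Lemma heis_grp_normal : heis_grp <| theis_grp.
Proof.
apply/andP; split.
  apply/subsetP=> -[[[a x] y] z]; rewrite mem_heis_grp mem_theis_grp => /eqP->.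
  exact: group1.
apply/subsetP=> -[[[a x] y] z] _; rewrite inE.
apply/subsetP=> _ /imsetP[[[[b x'] y'] z'] Pu ->]; move: Pu.
rewrite mem_heis_grp => /eqP->; rewrite /conjg inv_theisE !mul_theisE mem_heis_grp.
by rewrite mul1g mulVg.
Qed.

Lemma yz_grp_normal : yz_grp <| theis_grp.
Proof.
apply/andP; split.
  apply/subsetP=> -[[[a x] y] z]; rewrite mem_yz_grp mem_theis_grp => /andP[/eqP->].
  by rewrite group1.
apply/subsetP=> -[[[a x] y] z] _; rewrite inE.
apply/subsetP=> _ /imsetP[[[[b x'] y'] z'] Au ->]; move: Au.
rewrite mem_yz_grp => /andP[/eqP-> /eqP->].
have a0 : val a != 0 by rewrite -unitfE (valP a).
rewrite /conjg inv_theisE !mul_theisE mem_yz_grp mul1g mulVg eqxx /=.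
by apply/eqP; field.
Qed.

Lemma der_theis_grp_sub : [~: theis_grp, theis_grp] \subset heis_grp.
Proof.
rewrite gen_subG; apply/subsetP=> _ /imset2P[[[[a x] y] z] [[[b x'] y'] z'] Ua Ub ->].
rewrite /commg /conjg !inv_theisE !mul_theisE mem_heis_grp.
have cU : commute a b by apply: val_inj; rewrite /= mulrC.
(* The unit coordinate of a commutator is the commutator of the units a and b. *)
by rewrite -/(conjg _ _) -/(commg _ _); apply/commgP.
Qed.

Lemma heis_grp_nonabelian : ~~ abelian heis_grp.
Proof.
(* The two products of these elements have z coordinates 1 and 0. *)
apply/negP => /centsP/(_ (1%g, 1, 0, 0) _ (1%g, 0, 1, 0)).
rewrite !mem_heis_grp eqxx => /(_ isT isT).
rewrite /commute !mul_theisE => -[_ _ /eqP].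
by rewrite !(mul0r, mulr1, mulr0, addr0, add0r) oner_eq0.
Qed.

Lemma theis_quotient_nonabelian : U :!=: 1%g -> ~~ abelian (theis_grp / yz_grp).
Proof.
case/trivgPn=> a Ua a1; rewrite /abelian quotient_cents2 ?normal_norm ?yz_grp_normal //.
(* This commutator has x coordinate a - 1, which is nonzero, so it survives modulo the elements with
   a = 1 and x = 0. *)
apply/subsetPn; exists ([~ (1%g, 1, 0, 0) : theis, (a, 0, 0, 0) : theis]).
  by rewrite mem_commg // mem_theis_grp ?group1.
rewrite /commg /conjg !inv_theisE !mul_theisE mem_yz_grp negb_and; apply/orP; right.
rewrite !(mul0r, mulr1, mul1r, mulr0, addr0, add0r, invr1, oppr0) /=.
have a0 : val a != 0 by rewrite -unitfE (valP a).
by rewrite mul1r mulVf // mulN1r subr_eq0; apply: contra a1 => /eqP a1; apply/eqP/val_inj.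
Qed.

Local Open Scope nat_scope.

Lemma theis_grp_solvable p : prime p -> #|F| = p -> solvable theis_grp.
Proof.
move=> pr_p oF; rewrite (series_sol heis_grp_normal); apply/andP; split.
  apply: (@pgroup_sol _ p); rewrite /pgroup card_theis_set cards1 !cardsT oF.
  by rewrite !pnatM ?pnat_id ?pnat1 ?pr_p.
by rewrite abelian_sol // sub_der1_abelian // der_theis_grp_sub.
Qed.

Lemma theis_grp_cocktail p q :
    prime p -> prime q -> q < p -> #|F| = p -> #|U| = q ->
  cocktail theis_grp 1 /\ rho theis_grp =i [:: p; q].
Proof.
move=> pr_p pr_q q_lt_p oF oU.
have ntU : U :!=: 1%g by rewrite -cardG_gt1 oU prime_gt1.
have oG : #|theis_grp| = p ^ 3 * q by rewrite card_theis_set !cardsT oF oU; ring.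
have oP : #|heis_grp| = p ^ 3 by rewrite card_theis_set cards1 !cardsT oF; ring.
have oA : #|yz_grp| = p ^ 2 by rewrite card_theis_set !cards1 !cardsT oF; ring.
have oZ : #|z_grp| = p by rewrite card_theis_set !cards1 oF !mul1n.
have sZZ := sub_z_grp_center; have nsP := heis_grp_normal.
have nsA := yz_grp_normal; have nabP := heis_grp_nonabelian.
have nabGA := theis_quotient_nonabelian ntU.
split; first exact: (cocktail_two_degrees pr_p pr_q q_lt_p oG oP oA oZ).
exact: (rho_two_degrees pr_p pr_q q_lt_p oG oP oA oZ).
Qed.

End TwistedHeisenberg.

(** * Pairs of large primes and the induction on their number *)

(* Modulo any prime divisor p of 2^q - 1, the class of 2 has order q. *)
Lemma exists_unit_Fp_order q :
  prime q -> exists2 p, prime p & exists a : {unit 'F_p}, #[a]%g = q.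
Proof.
move=> pr_q; have gt1 : 1 < 2 ^ q - 1.
  by rewrite ltn_subRL (@leq_trans (2 ^ 2)) // leq_exp2l ?prime_gt1.
pose p := pdiv (2 ^ q - 1); have pr_p : prime p := pdiv_prime gt1.
exists p => //.
have two_q : (2%:R ^+ q = 1 :> 'F_p)%R.
  apply/eqP; rewrite -subr_eq0 -natrX -(@natrB _ _ 1) ?expn_gt0 //.
  by rewrite -(dvdn_pcharf (pchar_Fp pr_p)) pdiv_dvd.
have unit2 : (2%:R : 'F_p)%R \is a GRing.unit.
  by rewrite -(unitrX_pos _ (prime_gt0 pr_q)) two_q unitr1.
pose a := FinRing.unit 'F_p unit2; exists a.
have aq : (a ^+ q == 1)%g by apply/eqP/val_inj; rewrite FinRing.val_unitX /= two_q.
rewrite -order_dvdn in aq.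
have [_ /(_ _ aq)/orP[|/eqP//]] := primeP pr_q.
(* Order 1 would mean 2 = 1 in ['F_p]. *)
rewrite order_eq1 => /eqP/(congr1 val) /= /eqP.
by rewrite -subr_eq0 -(@natrB _ 2 1) // oner_eq0.
Qed.

(** The lower bound n allows each new pair of primes to avoid all earlier ones. *)
Lemma large_cocktail_pair n : exists (gT : finGroupType) (G : {group gT}),
  [/\ solvable G, cocktail G 1 & {in rho G, forall r, n < r}].
Proof.
have [q n_lt_q pr_q] := prime_above n.
have [p pr_p [a oa]] := exists_unit_Fp_order pr_q.
have oF : #|'F_p| = p by rewrite card_Fp.
(* By Lagrange, the order q of a divides p - 1, the order of the unit group. *)
have q_lt_p : q < p.
  have p1 := prime_gt1 pr_p; rewrite -(prednK (ltnW p1)) ltnS dvdn_leq //.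
    by rewrite -ltnS prednK // ltnW.
  by rewrite -oa -[in X in _ %| X]oF -card_finField_unit order_dvdG ?inE.
have [coG rhoE] := theis_grp_cocktail pr_p pr_q q_lt_p oF oa.
exists (theis 'F_p), (theis_grp <[a]>); split=> //.
  exact: theis_grp_solvable pr_p oF.
move=> r; rewrite rhoE !inE => /orP[]/eqP-> //.
exact: ltn_trans q_lt_p.
Qed.

Lemma exists_cocktail m : exists (gT : finGroupType) (G : {group gT}),
  solvable G /\ cocktail G m.
Proof.
elim: m => [|m [gT [G [solG coG]]]].
  (* The trivial group has 1 as its only degree, so its graph is empty. *)
  exists {perm void}, 1%G; split; first exact: solvable1.
  have rho0 : rho (1%G : {group {perm void}}) = [::].
    apply/eqP; rewrite -size_eq0 -leqn0 leqNgt -has_predT; apply/hasPn => p.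
    case/mem_rho=> a /cd_dvd_order; rewrite cards1 dvdn1 => /eqP-> /andP[pr_p].
    by rewrite dvdn1 => /eqP Dp; rewrite Dp in pr_p.
  by split; rewrite rho0.
(* Primes above the maximum of [rho G] are not in [rho G], as [cocktail_setX] requires. *)
have [hT [H [solH coH gtH]]] := large_cocktail_pair (\max_(r <- rho G) r).
exists (gT * hT)%type, (setX_group G H); split.
  have [[nsK _] defGH] := (dprod_normal2 (setX_dprod G H), setX_dprod G H).
  (* The quotient by the first factor is isomorphic to the second, so the product is an extension of
     solvable groups. *)
  have isoQ := sdprod_isog (dprodWsd defGH).
  rewrite (series_sol nsK) -(isog_sol isoQ) -(isog_sol (isog_setX1 hT G)) solG /=.
  by rewrite -(isog_sol (isog_set1X gT H)).
rewrite -addn1; apply: cocktail_setX => //; apply/hasPn => r rH.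
apply/negP => /= rG; have := gtH r rH; rewrite ltnNge => /negP; apply.
by rewrite (bigmaxn_sup_seq r).
Qed.

Theorem mainTheorem4 (k : nat) (k_ge2 : 2 <= k) (k_even : ~~ odd k) :
  exists (gT : finGroupType) (G : {group gT}),
    [/\ solvable G,
        regular_graph k (prime_graph (G := G)) &
        size (rho G) = k + 2].
Proof.
(* A perfect matching on k + 2 vertices has k/2 + 1 edges. *)
have [gT [G [solG coG]]] := exists_cocktail k./2.+1.
have Dk : k./2.*2 = k by rewrite -[RHS]odd_double_half (negPf k_even).
exists gT, G; split=> //; first by rewrite -{1}Dk; apply: cocktail_regular.
by rewrite coG.1 doubleS Dk addn2.
Qed.
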